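(* Let $n\ge2$ and $1\le c<n$ with $c\ge\lfloor n/2\rfloor$. For every $\mathbf{s}_n\in\mathcal{R}(n,c)$ one has $$nlc(\mathbf{s}_n^{\infty})=nlc(\mathbf{s}_n)+add(\mathbf{s}_n).$$
   Context: All sequences are binary (over $\mathbb{Z}_2=\{0,1\}$). A finite sequence $\mathbf{s}_n=(s_0,\dots,s_{n-1})$ is aperiodic if it is not of the form $(s_0,\dots,s_{k-1})^{n/k}$ (concatenation of $n/k$ copies) for a proper divisor $k$ of $n$. $\mathbf{s}_n^{\infty}$ is the infinite repetition of $\mathbf{s}_n$. Circular shifts: $L(\mathbf{s}_n)=(s_1,\dots,s_{n-1},s_0)$, $L^k$ its $k$-fold iterate, and $R^k=L^{n-k}$ (right circular shift by $k$). Nonlinear complexity: $nlc(\mathbf{s})$ of a finite or infinite sequence is the length of the shortest feedback shift register generating it, i.e. the least $m\ge 0$ such that there is a function $f:\mathbb{Z}_2^m\to\mathbb{Z}_2$ with $s_{i+m}=f(s_i,\dots,s_{i+m-1})$ for all $i\ge0$ for which $s_{i+m}$ is defined. For $1\le c<n$ and $1\le d\le\min\{n-c,\lfloor n/2\rfloor\}$, $\mathcal{B}(n,c,d)$ is the set of aperiodic binary sequences $\mathbf{s}_n$ such that $(s_0,\dots,s_{d-1})$ is aperiodic, $s_i=s_{i+d}$ for $0\le i\le c-2$, and $s_{c-1}\ne s_{c+d-1}$ (remaining terms arbitrary subject to $\mathbf{s}_n$ being aperiodic). $\mathcal{B}(n,c)=\bigcup_{d=1}^{\min\{n-c,\lfloor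 n/2\rfloor\}}\mathcal{B}(n,c,d)$. The parameter $d$ is called the spacing of $\mathbf{s}_n$; in the range $c\ge\lfloor n/2\rfloor$ it is regarded as determined by $\mathbf{s}_n$. For $\mathbf{s}_n\in\mathcal{B}(n,c,d)$, $add(\mathbf{s}_n)$ is the integer $t\ge0$ with $s_{n-1-i}=s_{(d-1-i)\bmod d}$ for $0\le i<t$ and $s_{n-1-t}\ne s_{(d-1-t)\bmod d}$. For $\mathbf{s}_n\in\mathcal{B}(n,c)$, $E(\mathbf{s}_n)=\{R^k(\mathbf{s}_n):0\le k<n\}\cap\mathcal{B}(n,c)$. $\mathcal{R}(n,c)$ is the set of all representatives: $\mathcal{R}(n,c)=\bigcup_{\mathbf{s}_n\in\mathcal{B}(n,c)}\{\widetilde{\mathbf{s}}_n\in E(\mathbf{s}_n): add(\widetilde{\mathbf{s}}_n)\ge add(\mathbf{a}_n)\ \forall\,\mathbf{a}_n\in E(\mathbf{s}_n)\}$. *)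

(* Defs.v *)
From mathcomp Require Import all_boot.
From mathcomp Require Import boolp.

Set Implicit Arguments.
Unset Strict Implicit.
Unset Printing Implicit Defensive.

Definition aperiodic (w : seq bool) : bool :=
  [forall k : 'I_(size w),
     (k %| size w) ==> (w != flatten (nseq (size w %/ k) (take k w)))].

(* A finite or infinite binary sequence is a function u : nat -> bool together
   with the predicate dom of the indices at which it is defined; the values of
   u outside dom are never constrained. *)
Definition fsr_generates (dom : pred nat) (u : nat -> bool) (m : nat) : Prop :=
  exists f : m.-tuple bool -> bool,
    forall i, dom (i + m) -> u (i + m) = f [tuple u (i + j) | j < m].

Lemma nlc_of_subproof (dom : pred nat) (u : nat -> bool) :
  (exists m, fsr_generates dom u m) -> exists m, `[< fsr_generates dom u m >].
Proof. by move=> [m um]; exists m; apply/asboolP. Qed.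

(* The length of the shortest generating register; the default value 0 is only
   taken by infinite sequences that no register generates, see fin_generated
   and periodic_generated. *)
Definition nlc_of (dom : pred nat) (u : nat -> bool) : nat :=
  if pselect (exists m, fsr_generates dom u m) is left h
  then ex_minn (nlc_of_subproof h) else 0.

Definition nlc (s : seq bool) : nat :=
  nlc_of (fun i => i < size s) (nth false s).

Definition nlc_inf (u : nat -> bool) : nat := nlc_of predT u.

Definition periodic_ext (s : seq bool) : nat -> bool :=
  fun i => nth false s (i %% size s).

Lemma nlc_ofP (dom : pred nat) (u : nat -> bool) :
  (exists m, fsr_generates dom u m) ->
  fsr_generates dom u (nlc_of dom u) /\
  (forall m, fsr_generates dom u m -> nlc_of dom u <= m).
Proof.
rewrite /nlc_of; case: pselect => // h _.
case: ex_minnP => m /asboolP um minm; split=> // k uk.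
by apply: minm; apply/asboolP.
Qed.

Lemma fin_generated (s : seq bool) :
  fsr_generates (fun i => i < size s) (nth false s) (size s).
Proof.
by exists (fun=> false) => i; rewrite ltnNge leq_addl.
Qed.

Lemma periodic_generated (s : seq bool) :
  fsr_generates predT (periodic_ext s) (size s).
Proof.
exists (fun w => nth false w 0) => i _; rewrite /periodic_ext modnDr.
case: (posnP (size s)) => [/size0nil->|s_gt0]; first by rewrite !nth_nil nth_default ?size_tuple.
by rewrite -[0]/(val (Ordinal s_gt0)) -tnth_nth tnth_mktuple /= addn0.
Qed.

Definition Bset (n c d : nat) : {set n.-tuple bool} :=
  [set s : n.-tuple bool |
    [&& aperiodic s, aperiodic (take d s),
        [forall i : 'I_c.-1, nth false s i == nth false s (i + d)]
      & nth false s (c - 1) != nth false s (c + d - 1)]].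

Definition Bunion (n c : nat) : {set n.-tuple bool} :=
  \bigcup_(1 <= d < (minn (n - c) n./2).+1) Bset n c d.

(* By the theorem of Fine and Wilf, for n./2 <= c there is exactly one such d
   when s \in Bunion n c, so the choice made by pick is immaterial. *)
Definition spacing (n c : nat) (s : n.-tuple bool) : nat :=
  if [pick d : 'I_(minn (n - c) n./2).+1 | (0 < d) && (s \in Bset n c d)] is Some d
  then d else 0.

(* The first t with s_(n-1-t) != s_((d-1-t) mod d), where (d-1-t) mod d is
   written d - 1 - t %% d because subtraction on nat is truncated. Such a t < n
   exists for s \in Bset n c d, since otherwise s would have period d. *)
Definition add_spaced (n d : nat) (s : n.-tuple bool) : nat :=
  find (fun t => nth false s (n - 1 - t) != nth false s (d - 1 - t %% d))
       (iota 0 n).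

Definition add (n c : nat) (s : n.-tuple bool) : nat :=
  add_spaced (spacing c s) s.

Definition Eset (n c : nat) (s : n.-tuple bool) : {set n.-tuple bool} :=
  [set [tuple of rotr k s] | k : 'I_n] :&: Bunion n c.

Definition Rset (n c : nat) : {set n.-tuple bool} :=
  \bigcup_(s in Bunion n c)
    [set r in Eset c s | [forall a in Eset c s, add c a <= add c r]].

(* Main.v *)
(** Let [u] be the bi-infinite periodic extension of [s], [d] the spacing and
[t = add s]. Calling "run" of difference [e] a maximal interval of [k] with
[u (k + e) = u k], the run of difference [d] ending at [c - 1] has length
[c - 1 + t]; the two windows it carries force any register of [u] to have length
at least [c + t], and Fine and Wilf's theorem gives [nlc s = c].

Conversely, a register of length [c + t] fails only if some run of difference
[e <= n/2] has length at least [c + t]. If [e <= n - c], after shrinking [e] so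
that its window is aperiodic, the rotation of [s] placing the end of that run at
[c - 1] is in [B(n,c,e)], with a value of [add] exceeding [t]: this contradicts
the choice of the representative. If [e > n - c], this long run and the run of
difference [d] cannot coexist on the circle of length [n]: moving the ends of
the [d]-run by [e] either lands inside that run, which is absurd, or puts the
whole [d]-run in a position where the differences [d], [e] and [n - e] can be
reduced by a Euclidean descent. *)

Require Import Defs.
From mathcomp Require Import all_boot boolp.
From Stdlib Require Import ZArith Lia.
From mathcomp Require Import zify.

Set Implicit Arguments.
Unset Strict Implicit.
Unset Printing Implicit Defensive.

Local Open Scope Z_scope.

(** * Runs of a fixed difference and residues *)

Lemma run_iter (T : Type) (u : Z -> T) (lo hi e : Z) :
  0 <= e -> (forall k, lo <= k < hi -> u (k + e) = u k) ->
  forall (m : nat) k, lo <= k -> k + Z.of_nat m * e < hi + e ->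
  u (k + Z.of_nat m * e) = u k.
Proof.
move=> e_ge0 run; elim=> [|m IHm] k k_lo k_hi; first by congr u; lia.
have -> : k + Z.of_nat m.+1 * e = k + Z.of_nat m * e + e by lia.
by rewrite run ?IHm //; nia.
Qed.

Lemma run_mod (T : Type) (u : Z -> T) (lo hi e : Z) :
  0 < e -> (forall k, lo <= k < hi -> u (k + e) = u k) ->
  forall k k', lo <= k < hi + e -> lo <= k' < hi + e ->
  k mod e = k' mod e -> u k = u k'.
Proof.
move=> e_gt0 run.
have le_run k k' : lo <= k <= k' -> k' < hi + e -> k mod e = k' mod e ->
    u k' = u k.
  move=> ? ? eq_mod.
  have [ek ek'] := (Z.div_mod k e ltac:(lia), Z.div_mod k' e ltac:(lia)).
  have Ek' : k' = k + Z.of_nat (Z.to_nat (k' / e - k / e)) * e.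
    have : k / e <= k' / e by apply: Z.div_le_mono; lia.
    by nia.
  by rewrite Ek'; apply: (run_iter _ run); lia.
move=> k k' ? ? eq_mod; have [le_kk'|lt_k'k] := Z.le_gt_cases k k'.
  by symmetry; apply: le_run => //; lia.
by apply: le_run => //; lia.
Qed.

(** * Opposed runs on a circle and their Euclidean descent *)

(* On the circle of length [d]: a run of difference [f] starting right after its
   violation at [0], and a run of difference [e] ending right before its
   violation at [tau + 1]. The lower bound on [p + q] survives every Euclidean
   step below, which is what makes the descent on [d + e + f] possible. *)
Definition opposed_runs (T : Type) (d e f : Z) : Prop :=
  exists tau p q (y : Z -> T),
  (0 < d /\ 0 <= e <= tau /\ 0 <= f <= tau /\ d + 2 * tau + 1 <= p + q + e + f)
  /\ (forall k, y (k + d) = y k)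
  /\ ((forall k, 1 <= k <= p -> y (k + f) = y k) /\ y f <> y 0)
  /\ ((forall k, tau - q < k <= tau -> y (k - e) = y k)
      /\ y (tau + 1 - e) <> y (tau + 1)).

(** The reflection [i |-> tau + 1 - i] exchanges the two violations, hence the two runs. *)
Lemma opposed_runs_rev (T : Type) (d e f : Z) :
  opposed_runs T d e f -> opposed_runs T d f e.
Proof.
move=> [tau [p [q [y [ineq [per [[Hf Vf] [He Ve]]]]]]]].
exists tau, q, p, (fun i => y (tau + 1 - i)); split; first lia.
split; first by move=> k /=; rewrite -(per (_ - _)); congr y; lia.
split; split.
- move=> k k_q; rewrite -(He (tau + 1 - k)); last lia.
  by congr y; lia.
- by move: Ve; rewrite Z.sub_0_r.
- move=> k k_p; rewrite -(Hf (tau + 1 - k)); last lia.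
  by congr y; lia.
- by rewrite Z.sub_diag (_ : tau + 1 - _ = f) //; lia.
Qed.

(** As [y] has period [d], a difference may be lowered by [d]; with [tau] also lowered by [d], both
    sides of the inequality drop by [2 * d]. *)
Lemma opposed_runs_period (T : Type) (d e f : Z) : d < e -> d < f ->
  opposed_runs T d e f -> opposed_runs T d (e - d) (f - d).
Proof.
move=> lt_de lt_df [tau [p [q [y [ineq [per [[Hf Vf] [He Ve]]]]]]]].
have per' i j : i = j + d -> y i = y j by move=> ->.
exists (tau - d), p, q, y; split; first lia; split=> //.
split; split.
- by move=> k k_p; rewrite -(Hf k k_p); symmetry; apply: per'; lia.
- by move=> E; apply: Vf; rewrite -E; apply: per'; lia.
- move=> k k_q; rewrite -(per k) -(He (k + d)); last lia.
  by congr y; lia.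
- move=> E; apply: Ve.
  by rewrite (per' (tau + 1) (tau - d + 1)) -?E; [congr y|]; lia.
Qed.

(** A difference [0] or [d] cannot be violated, and a run of length [d] would go round the circle
    and cover its own violation. *)
Lemma opposed_runs_bounded (T : Type) (d e f : Z) :
  opposed_runs T d e f ->
  exists tau p q (y : Z -> T),
  (0 < d /\ 0 < e <= tau /\ 0 < f <= tau /\ d + 2 * tau + 1 <= p + q + e + f
   /\ p < d /\ q < d /\ e <> d /\ f <> d)
  /\ (forall k, y (k + d) = y k)
  /\ ((forall k, 1 <= k <= p -> y (k + f) = y k) /\ y f <> y 0)
  /\ ((forall k, tau - q < k <= tau -> y (k - e) = y k)
      /\ y (tau + 1 - e) <> y (tau + 1)).
Proof.
move=> [tau [p [q [y [ineq [per [[Hf Vf] [He Ve]]]]]]]].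
have per' i j : i = j + d -> y i = y j by move=> ->.
exists tau, p, q, y; split=> //.
have e_neq0 : e <> 0 by move=> e0; apply: Ve; congr y; lia.
have f_neq0 : f <> 0 by move=> f0; apply: Vf; congr y; lia.
have e_neqd : e <> d by move=> ed; apply: Ve; symmetry; apply: per'; lia.
have f_neqd : f <> d by move=> fd; apply: Vf; apply: per'; lia.
have p_lt : p < d.
  apply/Z.nle_gt => le_dp; apply: Vf.
  have := Hf d ltac:(lia).
  by rewrite (per' (d + f) f) ?(per' d 0) //; lia.
have q_lt : q < d.
  apply/Z.nle_gt => le_dq; apply: Ve.
  have := He (tau + 1 - d) ltac:(lia).
  rewrite -(per' (tau + 1) (tau + 1 - d)); last lia.
  by rewrite -(per' (tau + 1 - e)) //; lia.
by lia.
Qed.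

(** If [d + e <= tau], then [tau] can be lowered by [d]; otherwise the runs are long enough to join
    [tau + 1] to [tau + 1 - e], against the violation there. *)
Lemma opposed_runs_mixed (T : Type) (d e f : Z) : e < d < f ->
  opposed_runs T d e f -> opposed_runs T d e (f - d).
Proof.
move=> [lt_ed lt_df] /opposed_runs_bounded.
move=> [tau [p [q [y [ineq [per [[Hf Vf] [He Ve]]]]]]]].
have per' i j : i = j + d -> y i = y j by move=> ->.
have Hf' i : 1 <= i <= p -> y (i + (f - d)) = y i.
  by move=> i_p; rewrite -(Hf i) //; symmetry; apply: per'; lia.
have [le_tau|lt_tau] := Z.le_gt_cases (d + e) tau.
  exists (tau - d), p, q, y; split; first lia; split=> //.
  split; split=> //.
  - by move=> E; apply: Vf; rewrite -E; apply: per'; lia.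
  - move=> k k_q; rewrite -(per k) -(He (k + d)); last lia.
    by rewrite -(per (k - e)); congr y; lia.
  - move=> E; apply: Ve.
    by rewrite (per' (tau + 1) (tau - d + 1)) -?E; [apply: per'|]; lia.
case: Ve.
(* Both positions reach [tau + 1 - f]: the first by the run of difference [f - d], the second by
   that run, the [e]-run and the period. *)
have E1 : y (tau + 1) = y (tau + 1 - f).
  rewrite (per' _ (tau + 1 - d)); last lia.
  by rewrite -(Hf' (tau + 1 - f)); [congr y|]; lia.
have E2 : y (tau + 1 - e) = y (tau + 1 - e - (f - d)).
  by rewrite -(Hf' (tau + 1 - e - (f - d))); [congr y|]; lia.
have E3 : y (tau + 1 - e - (f - d)) = y (tau + 1 - (f - d)).
  by rewrite -(He (tau + 1 - (f - d))); [congr y|]; lia.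
by rewrite E1 E2 E3; apply: per'; lia.
Qed.

(** On the circle, [d - e] is the step [e] taken backwards; translating by [f] brings the violation
    of the [f]-run back to [0]. *)
Lemma opposed_runs_flip (T : Type) (d e f : Z) : e < d -> f < d ->
  opposed_runs T d e f -> opposed_runs T d (d - e) (d - f).
Proof.
move=> lt_ed lt_fd [tau [p [q [y [ineq [per [[Hf Vf] [He Ve]]]]]]]].
have per' i j : i = j + d -> y i = y j by move=> ->.
exists (tau + d - e - f), p, q, (fun i => y (i + f)); split; first lia.
split; first by move=> k; apply: per'; lia.
split; split.
- by move=> k k_p; rewrite (Hf k k_p); apply: per'; lia.
- by rewrite (per' (d - f + f) 0) //; [exact: nesym | lia].
- move=> k k_q; rewrite (per' (k + f) (k + f + e - d - e)); last lia.
  by rewrite (He (k + f + e - d)); [congr y|]; lia.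
- rewrite (_ : _ + f = tau + 1); last lia.
  rewrite (per' (_ + f) (tau + 1 - e)); last lia.
  exact: nesym.
Qed.

(** Since [e + f <= d], one of the two runs is longer than [tau]. If it is the [e]-run, it gives [y]
    the difference [d - e] on [0..tau], so that a stretch of [y] closes up into a circle of length
    [d - e]; the other case is its reflection. *)
Lemma opposed_runs_cut (T : Type) (d e f : Z) : e < d -> f < d -> e + f <= d ->
  opposed_runs T d e f ->
  opposed_runs T (d - e) e f \/ opposed_runs T (d - f) f e.
Proof.
suff cut e' f' tau p q (y : Z -> T) : e' < d -> f' < d ->
  (0 < d /\ 0 < e' <= tau /\ 0 < f' <= tau
    /\ d + 2 * tau + 1 <= p + q + e' + f'
    /\ p < d /\ q < d /\ e' <> d /\ f' <> d)
  -> (forall k, y (k + d) = y k)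
  -> ((forall k, 1 <= k <= p -> y (k + f') = y k) /\ y f' <> y 0)
  -> ((forall k, tau - q < k <= tau -> y (k - e') = y k)
      /\ y (tau + 1 - e') <> y (tau + 1)) ->
  tau < q -> opposed_runs T (d - e') e' f'.
  move=> lt_ed lt_fd le_efd /opposed_runs_bounded.
  move=> [tau [p [q [y [ineq [per [Hf He]]]]]]].
  have [lt_q|le_q] := Z.lt_ge_cases tau q.
    by left; apply: (cut e f tau p q y).
  right.
  apply: (cut f e tau q p (fun i => y (tau + 1 - i))) => //; try lia.
  - by move=> k /=; rewrite -(per (_ - _)); congr y; lia.
  - case: He => He Ve; split; last by rewrite Z.sub_0_r.
    move=> k k_q; rewrite -(He (tau + 1 - k)); last lia.
    by congr y; lia.
  - case: Hf => Hf Vf; split; last first.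
      by rewrite Z.sub_diag (_ : tau + 1 - _ = f) //; lia.
    move=> k k_p; rewrite -(Hf (tau + 1 - k)); last lia.
    by congr y; lia.
move=> {f e}; move: e' f' => e f lt_ed lt_fd ineq per [Hf Vf] [He Ve] lt_q.
have per' i j : i = j + d -> y i = y j by move=> ->.
have d'_gt0 : 0 < d - e by lia.
have per_e k : 0 <= k < tau + 1 -> y (k + (d - e)) = y k.
  by move=> ?; rewrite -(He k) //; [apply: per'|]; lia.
have p_lt : p < d - e.
  apply/Z.nle_gt => le_p; apply: Vf.
  rewrite -(per_e f) -?(per_e 0); try lia.
  by rewrite -(Hf (0 + (d - e))); [congr y|]; lia.
pose z i := y ((i - 1) mod (d - e) + 1).
have mod_le i := Z.mod_pos_bound i (d - e) d'_gt0.
have zE i : 0 <= i < tau + 1 + (d - e) -> z i = y i.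
  move=> i_le; have := mod_le (i - 1) => mod_i.
  apply: (run_mod d'_gt0 per_e) => //; first lia.
  rewrite Zplus_mod Zmod_mod -Zplus_mod; congr (_ mod _); lia.
have zper i : z (i + (d - e)) = z i.
  rewrite /z (_ : i + (d - e) - 1 = i - 1 + 1 * (d - e)); last lia.
  by rewrite Z_mod_plus_full.
(* On the shorter circle the step at [k] is read at [k - e], which costs the [e]-run [e] terms; both
   sides of the inequality drop by [e]. *)
exists tau, p, (q - e), z; split; first lia; split=> //.
split; split.
- by move=> k k_p; rewrite !zE ?Hf //; lia.
- by rewrite !zE //; lia.
- move=> k k_q; rewrite -(zper k) -(zper (k - e)) !zE; try lia.
  rewrite (per' (k + (d - e)) (k - e)); last lia.
  rewrite -(He (k - e)); last lia.
  by apply: per'; lia.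
- by rewrite !zE //; lia.
Qed.

(** A difference above [d] is lowered by subtraction. When both are below [d], complementing lowers
    the sum if [d < e + f], and cutting the circle does otherwise. *)
Lemma opposed_runs_false (T : Type) (d e f : Z) : ~ opposed_runs T d e f.
Proof.
move=> runs.
have [m le_m] : exists m : nat, d + e + f <= Z.of_nat m.
  by exists (Z.to_nat (d + e + f)); lia.
elim: m d e f le_m runs => [|m IHm] d e f le_m runs.
all: have [tau [p [q [y [ineq _]]]]] := opposed_runs_bounded runs.
  by lia.
have [lt_ed|lt_de] : e < d \/ d < e by lia.
- have [lt_fd|lt_df] : f < d \/ d < f by lia.
  + have [lt_def|le_efd] := Z.lt_ge_cases d (e + f).
      by apply: (IHm d (d - e) (d - f)); [lia | exact: opposed_runs_flip].
    by case: (opposed_runs_cut lt_ed lt_fd le_efd runs) => /IHm; apply; lia.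
  + by apply: (IHm d e (f - d)); [lia | exact: opposed_runs_mixed].
- have [lt_fd|lt_df] : f < d \/ d < f by lia.
  + apply: (IHm d f (e - d)); first lia.
    by apply/opposed_runs_mixed/opposed_runs_rev.
  + by apply: (IHm d (e - d) (f - d)); [lia | exact: opposed_runs_period].
Qed.

(** * Incompatibility of two long runs on the circle of length [n] *)

(** The residues [M..n - 1] form an arc of [n - M] points, too short for a step [delta] in either
    direction round the circle. *)
Lemma gap_dist (n M k delta : Z) : 0 < M < n -> n - M <= delta <= M ->
  M <= k mod n -> M <= (k + delta) mod n -> False.
Proof.
move=> M_n delta_le Mk Mk'.
have := Z.mod_pos_bound k n ltac:(lia).
have := Z.mod_pos_bound (k + delta) n ltac:(lia).
have := Z.div_mod k n ltac:(lia).
have := Z.div_mod (k + delta) n ltac:(lia).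
set q' := (k + delta) / n; set q := k / n => ? ? ? ?.
have [?|?] : q' - q <= 0 \/ 1 <= q' - q by lia.
  by nia.
by nia.
Qed.

Lemma periodic_mod (T : Type) (u : Z -> T) (n : Z) : 0 < n ->
  (forall k, u (k + n) = u k) -> forall k k', k mod n = k' mod n -> u k = u k'.
Proof.
move=> n_gt0 per k k'.
by apply: (@run_mod _ u (Z.min k k') (Z.max k k')) => //; lia.
Qed.

(** The left end [x - 1] lies where the [e]-run says nothing. Then so does [x + p + d], and the word
    of period [d] carried by the [d]-run has opposed runs of differences [e] and [n - e], whose
    violations come from those of the [d]-run. *)
Lemma two_runs_left (T : Type) (n p M x d e : Z) (u : Z -> T) :
  0 < d < n -> p < M < n -> e <= p -> n - e <= p ->
  (forall k, u (k + n) = u k) ->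
  (forall k, x <= k < x + p -> u (k + d) = u k) ->
  u (x - 1 + d) <> u (x - 1) -> u (x + p + d) <> u (x + p) ->
  (forall k, 0 <= k < M -> u (k + e) = u k) ->
  M - n <= x - 1 < 0 -> False.
Proof.
move=> d_n p_M e_p ne_p per d_run d_left d_right e_run x_lt.
have per' i j : i = j + n -> u i = u j by move=> ->.
have e_run' i j : 0 <= j < M -> i = j + e -> u i = u j.
  by move=> j_M ->; apply: e_run.
(* Otherwise the [e]-run would move the violation at [x + p] to [x + p + e - n], inside the
   [d]-run. *)
have Y_M : M <= x + p + d < n.
  suff : ~ (x + p + d < M) /\ ~ (n <= x + p + d) by lia.
  split=> [lt_Y|le_Y]; apply: d_right.
  - rewrite -(e_run' (x + p + d + e) (x + p + d)); try lia.
    rewrite -(e_run' (x + p + e) (x + p)); try lia.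
    rewrite (per' (x + p + d + e) (x + p + e - n + d)); last lia.
    rewrite (per' (x + p + e) (x + p + e - n)); last lia.
    by apply: d_run; lia.
  - rewrite (per' _ (x + p + d - n)); last lia.
    rewrite -(e_run' (x + p + d - n + e) (x + p + d - n)); try lia.
    rewrite -(e_run' (x + p + e) (x + p)); try lia.
    rewrite (per' (x + p + e) (x + p + e - n)); last lia.
    by rewrite -(d_run (x + p + e - n)); [congr u|]; lia.
apply: (@opposed_runs_false T d e (n - e)).
have d_gt0 : 0 < d by lia.
pose y i := u (x + (i - 1) mod d).
have yE i : 1 <= i < p + d + 1 -> y i = u (x - 1 + i).
  move=> i_le; have := Z.mod_pos_bound (i - 1) d d_gt0 => mod_i.
  have run k : 0 <= k < p -> u (x + (k + d)) = u (x + k).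
    by move=> k_p; rewrite -(d_run (x + k)); [congr u|]; lia.
  rewrite /y (run_mod d_gt0 run (k' := i - 1)) ?Zmod_mod //; try lia.
  by congr u; lia.
have yper i : y (i + d) = y i.
  rewrite /y (_ : i + d - 1 = i - 1 + 1 * d); last lia.
  by rewrite Z_mod_plus_full.
(* The two lengths are what the [e]-run leaves inside the window; with them the inequality becomes
   [p + 1 <= M]. *)
exists p, (M - (n - e) - x), (x + p + d - e), y; split; first lia; split=> //.
split; split.
- move=> k k_le; rewrite !yE; try lia.
  rewrite -(e_run' (x - 1 + k + n) (x - 1 + (k + (n - e)))); try lia.
  by apply: per'; lia.
- rewrite -(yper 0) !yE; try lia.
  rewrite (_ : x - 1 + (n - e) = x - 1 + n - e); last lia.
  rewrite -(e_run' (x - 1 + n) (x - 1 + n - e)); try lia.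
  rewrite per; exact: nesym.
- move=> k k_le; rewrite -(yper k) -(yper (k - e)) !yE; try lia.
  by symmetry; apply: e_run'; lia.
- rewrite -(yper (_ - e)) !yE; try lia.
  rewrite -(e_run' (x + p + d) (x - 1 + (p + 1 - e + d))); try lia.
  by rewrite (_ : x - 1 + (p + 1) = x + p) //; lia.
Qed.

Lemma two_runs_left_mod (T : Type) (n p M x d e : Z) (u : Z -> T) :
  0 < d < n -> p < M < n -> e <= p -> n - e <= p ->
  (forall k, u (k + n) = u k) ->
  (forall k, x <= k < x + p -> u (k + d) = u k) ->
  u (x - 1 + d) <> u (x - 1) -> u (x + p + d) <> u (x + p) ->
  (forall k, 0 <= k < M -> u (k + e) = u k) ->
  M <= (x - 1) mod n -> False.
Proof.
move=> d_n p_M e_p ne_p per d_run d_left d_right e_run x_mod.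
pose q := (x - 1) / n + 1.
have xE := Z.div_mod (x - 1) n ltac:(lia).
have shift k : u (k - q * n) = u k.
  apply: (@periodic_mod _ u n) => //; first lia.
  by rewrite (_ : k - q * n = k + (- q) * n) ?Z_mod_plus_full //; lia.
have shift' i j : i = j - q * n -> u i = u j by move=> ->.
apply: (@two_runs_left T n p M (x - q * n) d e u) => //.
- move=> k k_p; rewrite (shift' (k + d) (k + q * n + d)); last lia.
  by rewrite (shift' k (k + q * n)) ?d_run //; lia.
- by rewrite (shift' (_ + d) (x - 1 + d)) ?(shift' (_ - 1) (x - 1)) //; lia.
- by rewrite (shift' (_ + d) (x + p + d)) ?(shift' (_ + p) (x + p)) //; lia.
- by have := Z.mod_pos_bound (x - 1) n ltac:(lia); rewrite /q; lia.
Qed.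

(* The points where the [e]-run fails form an arc shorter than [n - p], so it
   cannot contain both ends [x - 1] and [x + p] of the [d]-run, nor two points at
   distance [e]; outside this arc an end of the [d]-run moves by [e] into the
   [d]-run. *)
Lemma two_runs (T : Type) (n p M x d e : Z) (u : Z -> T) :
  0 < d < n -> p < M < n -> e <= p -> n - e <= p ->
  (forall k, u (k + n) = u k) ->
  (forall k, x <= k < x + p -> u (k + d) = u k) ->
  u (x - 1 + d) <> u (x - 1) -> u (x + p + d) <> u (x + p) ->
  (forall k, 0 <= k < M -> u (k + e) = u k) -> False.
Proof.
move=> d_n p_M e_p ne_p per d_run d_left d_right e_run.
have n_gt0 : 0 < n by lia.
have [a_out|a_in] := Z.le_gt_cases M ((x - 1) mod n).
  exact: (@two_runs_left_mod T n p M x d e u).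
have [c_out|c_in] := Z.le_gt_cases M ((x + p + d - e) mod n).
  (* The reflection [k |-> e + M - 1 - k] preserves the [e]-run and sends [x + p + d] to the left
     end of the reflected [d]-run. *)
  apply: (@two_runs_left_mod T n p M (e + M - d - x - p) d e
            (fun k => u (e + M - 1 - k))) => //.
  - by move=> k; rewrite -per; congr u; lia.
  - by move=> k k_le; rewrite -(d_run (e + M - 1 - (k + d))); [congr u|]; lia.
  - rewrite (_ : e + M - 1 - (e + M - d - x - p - 1 + d) = x + p); last lia.
    rewrite (_ : e + M - 1 - (e + M - d - x - p - 1) = x + p + d); last lia.
    exact: nesym.
  - rewrite (_ : e + M - 1 - (e + M - d - x - p + p + d) = x - 1); last lia.
    rewrite (_ : e + M - 1 - (e + M - d - x - p + p) = x - 1 + d); last lia.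
    exact: nesym.
  - by move=> k k_le; rewrite -(e_run (e + M - 1 - (k + e))); [congr u|]; lia.
  - set r := _ mod n in c_out.
    have r_lt := Z.mod_pos_bound (x + p + d - e) n n_gt0.
    rewrite (_ : _ mod n = M - 1 - r + n); first by rewrite -/r in r_lt; lia.
    symmetry; apply: (@Z.mod_unique _ _ (- ((x + p + d - e) / n) - 1)).
      by left; rewrite -/r in r_lt; lia.
    by have := Z.div_mod (x + p + d - e) n ltac:(lia); rewrite -/r; lia.
have e_run_mod k : k mod n < M -> u (k + e) = u k.
  move=> k_lt; have k_ge := Z.mod_pos_bound k n n_gt0.
  rewrite -(periodic_mod n_gt0 per (Zmod_mod k n)) -(e_run (k mod n)); last lia.
  by apply: (periodic_mod n_gt0 per); rewrite Zplus_mod_idemp_l.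
have ad_out : M <= (x - 1 + d) mod n.
  apply/Z.nlt_ge => lt_ad; apply: d_left.
  rewrite -(e_run_mod _ lt_ad) -(e_run_mod _ a_in).
  rewrite -(d_run (x - 1 + e)); last lia.
  by congr u; lia.
have be_out : M <= (x + p - e) mod n.
  apply/Z.nlt_ge => lt_be; apply: d_right.
  rewrite (_ : x + p + d = x + p + d - e + e); last lia.
  rewrite {2}(_ : x + p = x + p - e + e); last lia.
  rewrite !e_run_mod // -(d_run (x + p - e)); last lia.
  by congr u; lia.
have bd_in : (x + p + d) mod n < M.
  apply/Z.nle_gt => le_bd.
  apply: (@gap_dist n M (x - 1 + d) (p + 1)) => //; try lia.
  by rewrite (_ : _ + (p + 1) = x + p + d) //; lia.
have b_in : (x + p) mod n < M.
  apply/Z.nle_gt => le_b.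
  apply: (@gap_dist n M (x + p - e) e) => //; try lia.
  by rewrite (_ : _ + e = x + p) //; lia.
apply: d_right.
rewrite -(e_run_mod _ bd_in) -(e_run_mod _ b_in).
rewrite (_ : x + p + d + e = x + p + e - n + d + n); last lia.
rewrite per (d_run (x + p + e - n)); last lia.
by rewrite -(per (x + p + e - n)); congr u; lia.
Qed.

(** * The theorem of Fine and Wilf *)

(** Modulo [d] every position reduces to one of the window [w..w + d - 1]; as [g] divides [d], its
    residue modulo [g] is kept. *)
Lemma window_period (T : Type) (u : Z -> T) (lo hi w d g : Z) :
  0 < g -> (g | d) -> 0 < d ->
  (forall k, lo <= k < hi -> u (k + d) = u k) -> lo <= w <= hi ->
  (forall k, w <= k < w + d - g -> u (k + g) = u k) ->
  forall k k', lo <= k < hi + d -> lo <= k' < hi + d ->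
  k mod g = k' mod g -> u k = u k'.
Proof.
move=> g_gt0 g_dvd d_gt0 d_run w_in g_run.
have red k : lo <= k < hi + d -> u k = u (w + (k - w) mod d).
  move=> k_in; have := Z.mod_pos_bound (k - w) d d_gt0 => ?.
  apply: (run_mod d_gt0 d_run) => //; first lia.
  by rewrite Zplus_mod_idemp_r; congr (_ mod _); lia.
move=> k k' k_in k'_in eq_mod; rewrite red // [RHS]red //.
have := Z.mod_pos_bound (k - w) d d_gt0 => ?.
have := Z.mod_pos_bound (k' - w) d d_gt0 => ?.
apply: (run_mod g_gt0 g_run); try lia.
have mod_mod j : (w + (j - w) mod d) mod g = j mod g.
  have [b dE] := g_dvd.
  have := Z.div_mod (j - w) d ltac:(lia).
  move: (_ mod _) ((j - w) / _) => r c jE.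
  rewrite {}dE in jE; rewrite (_ : w + r = j + (- (b * c)) * g); last lia.
  by rewrite Z_mod_plus_full.
by rewrite !mod_mod.
Qed.

(** Euclid by subtraction: for [p < q] the prefix of length [L - p] has periods [p] and [q - p],
    hence their gcd. It contains a full window of length [p], from which the [p]-run spreads the gcd
    to the rest. *)
Lemma Fine_Wilf (T : Type) (u : Z -> T) (L p q : Z) : 0 < p -> 0 < q ->
  p + q - Z.gcd p q <= L ->
  (forall k, 0 <= k < L - p -> u (k + p) = u k) ->
  (forall k, 0 <= k < L - q -> u (k + q) = u k) ->
  forall k, 0 <= k < L - Z.gcd p q -> u (k + Z.gcd p q) = u k.
Proof.
have [m le_m] : exists m : nat, p + q <= Z.of_nat m.
  by exists (Z.to_nat (p + q)); lia.
elim: m p q L le_m => [|m IHm] p q L le_m p_gt0 q_gt0; first lia.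
wlog le_pq : p q le_m p_gt0 q_gt0 / p <= q => [wlog_pq|].
  have [le_pq|lt_qp] := Z.le_gt_cases p q; first exact: wlog_pq.
  by rewrite Z.gcd_comm => *; apply: (wlog_pq q p) => //; lia.
move=> le_L per_p per_q.
have [eq_pq|lt_pq] : p = q \/ p < q by lia.
  by move: le_L; rewrite eq_pq Z.gcd_diag_nonneg -?eq_pq //; lia.
have gcdE : Z.gcd p (q - p) = Z.gcd p q by rewrite Z.gcd_sub_diag_r.
have g_ge0 := Z.gcd_nonneg p q.
have le_gqp : Z.gcd p q <= q - p.
  by rewrite -gcdE; apply: Z.divide_pos_le (Z.gcd_divide_r _ _); lia.
have per_g k : 0 <= k < L - p - Z.gcd p q -> u (k + Z.gcd p q) = u k.
  rewrite -gcdE; apply: (IHm p (q - p)); rewrite ?gcdE; try lia.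
    by move=> j j_le; apply: per_p; lia.
  move=> j j_le; rewrite -(per_q j) -?(per_p (j + (q - p))); try lia.
  by congr u; lia.
have g_gt0 : 0 < Z.gcd p q.
  by have := Z.gcd_eq_0_l p q; lia.
move=> k k_le.
apply: (@window_period T u 0 (L - p) 0 p (Z.gcd p q)) => //; try lia.
- exact: Z.gcd_divide_l.
- by move=> j j_le; apply: per_g; lia.
- by rewrite (_ : k + _ = k + 1 * Z.gcd p q) ?Z_mod_plus_full //; lia.
Qed.

Local Close Scope Z_scope.

(** * Proper powers, and registers as absence of conflicting windows *)

Lemma nth_flatten_nseq (T : Type) (x : T) (v : seq T) (m i : nat) :
  i < m * size v -> nth x (flatten (nseq m v)) i = nth x v (i %% size v).
Proof.
elim: m i => [|m IHm] i; first by rewrite mul0n.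
rewrite mulSn /= nth_cat => i_lt.
have [lt_i|le_i] := ltnP i (size v); first by rewrite modn_small.
rewrite IHm ?ltn_subLR //.
by rewrite -{2}(subnK le_i) modnDr.
Qed.

Lemma aperiodicPn (w : seq bool) :
  reflect (exists k, [/\ k < size w, k %| size w
      & forall i, i < size w -> nth false w i = nth false w (i %% k)])
    (~~ aperiodic w).
Proof.
have w_eq k : k < size w -> k %| size w ->
    reflect (forall i, i < size w -> nth false w i = nth false w (i %% k))
      (w == flatten (nseq (size w %/ k) (take k w))).
  move=> k_lt k_dvd.
  have k_gt0 : 0 < k by rewrite (dvdn_gt0 _ k_dvd) // (leq_ltn_trans _ k_lt).
  have size_take_k : size (take k w) = k by rewrite size_takel // ltnW.
  have nth_flat i : i < size w ->
      nth false (flatten (nseq (size w %/ k) (take k w))) i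
      = nth false w (i %% k).
    move=> i_lt; rewrite nth_flatten_nseq size_take_k ?divnK //.
    by rewrite nth_take // ltn_pmod.
  apply: (iffP eqP) => [w_flat i i_lt|w_mod].
    by rewrite -nth_flat -?w_flat.
  apply: (@eq_from_nth _ false) => [|i i_lt]; last by rewrite nth_flat -?w_mod.
  rewrite size_flatten /shape map_nseq size_take_k sumn_nseq mulnC divnK //.
rewrite negb_forall; apply: (iffP existsP) => [[k]|[k [k_lt k_dvd w_mod]]].
  rewrite negb_imply negbK => /andP [k_dvd /w_eq w_mod].
  by exists k; split=> //; apply: w_mod.
exists (Ordinal k_lt); rewrite negb_imply k_dvd negbK /=.
exact/w_eq.
Qed.

Lemma fsr_generatesP (dom : pred nat) (u : nat -> bool) (m : nat) :
  fsr_generates dom u m <->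
  forall i j, dom (i + m) -> dom (j + m) ->
    (forall k, k < m -> u (i + k) = u (j + k)) -> u (i + m) = u (j + m).
Proof.
split=> [[f f_gen] i j dom_i dom_j eq_ij|no_conflict].
  rewrite !f_gen //; congr f; apply: eq_from_tnth => k.
  by rewrite !tnth_mktuple eq_ij.
(* The register returns true exactly on the windows that are somewhere followed by true. *)
exists (fun w => `[< exists i, [/\ dom (i + m), w = [tuple u (i + j) | j < m]
                              & u (i + m)] >]) => i dom_i.
apply/idP/asboolP => [u_im|[j [dom_j /eqP eq_ij u_jm]]]; first by exists i.
rewrite (no_conflict i j) // => k k_lt.
have := congr1 (fun w => tnth w (Ordinal k_lt)) (eqP eq_ij).
by rewrite !tnth_mktuple.
Qed.

Lemma nlc_of_eq (dom : pred nat) (u : nat -> bool) (v : nat) :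
  fsr_generates dom u v ->
  (forall m, m < v -> ~ fsr_generates dom u m) -> nlc_of dom u = v.
Proof.
move=> gen_v not_gen; have [gen min] := nlc_ofP (ex_intro _ v gen_v).
apply/eqP; rewrite eqn_leq min // leqNgt; apply/negP => /not_gen; exact.
Qed.

(** * Words as bi-infinite periodic sequences *)

(** Integer indices avoid truncated subtraction: translations and reflections are total, and
    negative positions read the end of the word. *)
Definition cyclic (s : seq bool) (k : Z) : bool :=
  nth false s (Z.to_nat (k mod Z.of_nat (size s))).

Section Cyclic.

Variables (n : nat) (s : n.-tuple bool).
Hypothesis n_gt0 : 0 < n.

Lemma cyclicD k : cyclic s (k + Z.of_nat n) = cyclic s k.
Proof.
rewrite /cyclic size_tuple (_ : k + _ = k + 1 * Z.of_nat n)%Z; last lia.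
by rewrite Z_mod_plus_full.
Qed.

Lemma cyclic_nat i : i < n -> cyclic s (Z.of_nat i) = nth false s i.
Proof.
by move=> i_lt; rewrite /cyclic size_tuple Z.mod_small ?Nat2Z.id //; lia.
Qed.

Lemma cyclic_periodic_ext i : cyclic s (Z.of_nat i) = periodic_ext s i.
Proof.
rewrite /cyclic /periodic_ext size_tuple; congr nth.
have i_mod := ltn_pmod i n_gt0; have iE := divn_eq i n.
rewrite -(Z.mod_unique (Z.of_nat i) (Z.of_nat n) (Z.of_nat (i %/ n))
                       (Z.of_nat (i %% n))); lia.
Qed.

Lemma primitive_prefix d g : d <= n -> aperiodic (take d s) ->
  (0 < g)%Z -> (g | Z.of_nat d)%Z ->
  (forall k k', 0 <= k < Z.of_nat d -> 0 <= k' < Z.of_nat d ->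
    k mod g = k' mod g -> cyclic s k = cyclic s k')%Z -> (Z.of_nat d <= g)%Z.
Proof.
move=> le_dn aper g_gt0 [b dE] g_per; apply/Z.nlt_ge => lt_gd.
suff : ~~ aperiodic (take d s) by rewrite aper.
apply/aperiodicPn; exists (Z.to_nat g); rewrite size_takel ?size_tuple //.
have g_lt : Z.to_nat g < d by lia.
split=> //; first by apply/dvdnP; exists (Z.to_nat b); nia.
move=> i i_lt; have i_mod := ltn_pmod i (_ : 0 < Z.to_nat g).
have lt_mod : i %% Z.to_nat g < d by apply: leq_ltn_trans (leq_mod _ _) i_lt.
rewrite !nth_take // -!cyclic_nat; try lia.
apply: g_per; try lia.
have iE := divn_eq i (Z.to_nat g).
rewrite (_ : Z.of_nat i =
  Z.of_nat (i %% Z.to_nat g) + Z.of_nat (i %/ Z.to_nat g) * g)%Z.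
  by rewrite Z_mod_plus_full.
by rewrite [in LHS]iE; nia.
Qed.

Lemma aperiodic_cyclic k : aperiodic s -> 0 < k < n -> k %| n ->
  ~ forall i, cyclic s (i + Z.of_nat k) = cyclic s i.
Proof.
move=> aper /andP [k_gt0 k_lt] k_dvd k_per.
suff : ~~ aperiodic s by rewrite aper.
apply/aperiodicPn; exists k; rewrite size_tuple; split=> // i i_lt.
have lt_mod : i %% k < n by apply: leq_ltn_trans (leq_mod _ _) i_lt.
rewrite -!cyclic_nat //; have iE := divn_eq i k.
apply: (@periodic_mod _ _ (Z.of_nat k)) => //; first lia.
rewrite (_ : Z.of_nat i = Z.of_nat (i %% k) + Z.of_nat (i %/ k) * Z.of_nat k)%Z.
  by rewrite Z_mod_plus_full.
by rewrite [in LHS]iE; nia.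
Qed.

(** As [c + d <= n], all positions involved lie in [0..n - 1], where [cyclic s] reads [s] itself. *)
Lemma BsetP c d : 0 < c -> 0 < d -> c + d <= n ->
  s \in Bset n c d <->
  [/\ aperiodic s, aperiodic (take d s),
    forall k, (0 <= k < Z.of_nat c - 1 ->
      cyclic s (k + Z.of_nat d) = cyclic s k)%Z
    & cyclic s (Z.of_nat c - 1 + Z.of_nat d) <> cyclic s (Z.of_nat c - 1)].
Proof.
move=> c_gt0 d_gt0 le_cd.
have c1E : (Z.of_nat c - 1 = Z.of_nat (c - 1))%Z by lia.
have c1dE : (Z.of_nat (c - 1) + Z.of_nat d = Z.of_nat (c + d - 1))%Z by lia.
rewrite inE c1E c1dE !cyclic_nat; try lia.
split=> [/and4P [aper aper_d /forallP run viol]|[aper aper_d run viol]].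
  split=> // [k k_lt|]; last by apply/eqP; rewrite eq_sym.
  have lt_k : Z.to_nat k < c.-1 by lia.
  have /eqP := run (Ordinal lt_k); rewrite /= => runk.
  rewrite -(Z2Nat.id k); last lia.
  by rewrite -Nat2Z.inj_add !cyclic_nat ?runk //; lia.
apply/and4P; split=> //; last by rewrite eq_sym; apply/eqP.
apply/forallP => k; have k_lt := ltn_ord k.
rewrite -!cyclic_nat; try lia.
by rewrite Nat2Z.inj_add run //; lia.
Qed.

End Cyclic.

(** * Complexity of the finite word and uniqueness of the spacing *)

(** Equal windows at [i] and [j] form a run of difference [j - i]. It overlaps the [d]-run enough
    for Fine and Wilf, and aperiodicity of the first [d] terms then forces the gcd of the two
    differences to be [d]. *)
Lemma Bset_no_conflict n c d (s : n.-tuple bool) (i j : Z) :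
  0 < c -> n./2 <= c -> 0 < d -> d <= n./2 -> c + d <= n ->
  s \in Bset n c d ->
  (0 <= i < j)%Z -> (j + Z.of_nat c < Z.of_nat n)%Z ->
  (forall k, 0 <= k < Z.of_nat c -> cyclic s (i + k) = cyclic s (j + k))%Z ->
  cyclic s (i + Z.of_nat c)%Z = cyclic s (j + Z.of_nat c)%Z.
Proof.
move=> c_gt0 le_c d_gt0 le_d le_cd sB ij j_le eq_ij.
have n_gt0 : 0 < n by lia.
have [aper aper_d run viol] := iffLR (BsetP s n_gt0 c_gt0 d_gt0 le_cd) sB.
have e_run k : (i <= k < i + Z.of_nat c)%Z ->
    cyclic s (k + (j - i))%Z = cyclic s k.
  move=> k_in; rewrite -{2}(Z.sub_add i k) Z.add_comm (Z.add_comm _ i) eq_ij.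
    by congr cyclic; lia.
  lia.
set g := Z.gcd (Z.of_nat d) (j - i).
have g_gt0 : (0 < g)%Z.
  have := Z.gcd_eq_0_l (Z.of_nat d) (j - i).
  by have := Z.gcd_nonneg (Z.of_nat d) (j - i); lia.
have [g_dvd_d g_dvd_e] : (g | Z.of_nat d)%Z /\ (g | j - i)%Z.
  by split; [exact: Z.gcd_divide_l | exact: Z.gcd_divide_r].
have le_ge : (g <= j - i)%Z by apply: Z.divide_pos_le => //; lia.
have le_gd : (g <= Z.of_nat d)%Z by apply: Z.divide_pos_le => //; lia.
have primitive L : (Z.of_nat d + (j - i) - g <= L)%Z -> (Z.of_nat d <= L)%Z ->
    (i <= Z.of_nat c - 1)%Z ->
    (i + L <= Z.of_nat c - 1 + Z.of_nat d)%Z -> (i + L <= j + Z.of_nat c)%Z ->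
    (Z.of_nat d <= g)%Z.
  move=> L_ge L_ged i_le L_le1 L_le2.
  have g_run k : (0 <= k < L - g)%Z ->
      cyclic s (i + (k + g))%Z = cyclic s (i + k)%Z.
    move=> k_le; apply: (@Fine_Wilf _ (fun k => cyclic s (i + k)%Z) L
      (Z.of_nat d) (j - i)) => //; try lia.
      by move=> h h_le; rewrite Z.add_assoc run //; lia.
    by move=> h h_le; rewrite Z.add_assoc e_run //; lia.
  apply: (primitive_prefix n_gt0 _ aper_d) => //; first lia.
  move=> k k' k_le k'_le.
  apply: (window_period g_gt0 g_dvd_d _ run (w := i)); try lia.
  move=> h h_le; rewrite -{2}(Zplus_minus i h) -g_run; last lia.
  by congr cyclic; lia.
(* If [j < d], the range of the [d]-run contains [i..j + c - 1], and [d <= g <= j - i < d] is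
   absurd. *)
have [lt_jd|le_dj] := Z.lt_ge_cases j (Z.of_nat d).
  by have := primitive (j - i + Z.of_nat c)%Z; lia.
have le_dg : (Z.of_nat d <= g)%Z.
  by apply: (primitive (Z.of_nat c + Z.of_nat d - 1 - i)%Z); lia.
(* Moving [c - 1 + d] back by [j - i], a multiple of [d], keeps its class modulo [d] and lands in
   the range of the [d]-run. *)
case: viol.
rewrite -{1}(Z.sub_add (j - i) (Z.of_nat c - 1 + Z.of_nat d)) e_run; last lia.
apply: (run_mod _ run); try lia.
have [b eE] := g_dvd_e.
rewrite (_ : _ - (j - i) = Z.of_nat c - 1 + (1 - b) * Z.of_nat d)%Z; last nia.
by rewrite Z_mod_plus_full.
Qed.

Lemma nlc_Bset n c d (s : n.-tuple bool) :
  0 < c -> n./2 <= c -> 0 < d -> d <= n./2 -> c + d <= n ->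
  s \in Bset n c d -> nlc s = c.
Proof.
move=> c_gt0 le_c d_gt0 le_d le_cd sB.
have n_gt0 : 0 < n by lia.
have [_ _ run viol] := iffLR (BsetP s n_gt0 c_gt0 d_gt0 le_cd) sB.
apply: nlc_of_eq => [|m lt_mc] /=; rewrite ?size_tuple.
  apply/fsr_generatesP => i j /=.
  wlog lt_ij : i j / i < j => [wlog_ij dom_i dom_j eq_ij|].
    have [lt_ij|lt_ji|->//] := ltngtP i j; first exact: wlog_ij.
    by symmetry; apply: wlog_ij => // k k_lt; rewrite eq_ij.
  move=> dom_i dom_j eq_ij; rewrite -!(cyclic_nat s n_gt0) // !Nat2Z.inj_add.
  apply: (Bset_no_conflict c_gt0 le_c d_gt0 le_d le_cd sB); try lia.
  move=> k k_lt; rewrite -(Z2Nat.id k) -?Nat2Z.inj_add; last lia.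
  by rewrite !cyclic_nat ?eq_ij //; lia.
(* The windows of length [m] just before [c - 1] and [c - 1 + d] agree by the [d]-run, but their
   successors differ. *)
move=> /fsr_generatesP /= gen; apply: viol.
have -> : (Z.of_nat c - 1 + Z.of_nat d = Z.of_nat (c - 1 - m + d + m))%Z by lia.
have -> : (Z.of_nat c - 1 = Z.of_nat (c - 1 - m + m))%Z by lia.
rewrite !cyclic_nat ?(gen (c - 1 - m + d) (c - 1 - m)) //; try lia.
move=> k k_lt; rewrite -!(cyclic_nat s n_gt0) //; try lia.
rewrite -(run (Z.of_nat (c - 1 - m + k))); last lia.
by congr cyclic; lia.
Qed.

(** By Fine and Wilf the prefix of length [c + d - 1] has the gcd of [d] and [d'] as a period. This
    gcd is at most [d < d'], which the aperiodic prefix of length [d'] forbids. *)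
Lemma Bset_inj n c d d' (s : n.-tuple bool) :
  0 < c -> n./2 <= c -> 0 < d -> d < d' -> d' <= n./2 -> c + d' <= n ->
  s \in Bset n c d -> s \in Bset n c d' -> False.
Proof.
move=> c_gt0 le_c d_gt0 lt_dd' le_d' le_cd' sB sB'.
have [n_gt0 d'_gt0 le_cd] : [/\ 0 < n, 0 < d' & c + d <= n] by split; lia.
have [_ _ run _] := iffLR (BsetP s n_gt0 c_gt0 d_gt0 le_cd) sB.
have [_ aper run' _] := iffLR (BsetP s n_gt0 c_gt0 d'_gt0 le_cd') sB'.
set g := Z.gcd (Z.of_nat d) (Z.of_nat d').
have g_gt0 : (0 < g)%Z.
  have := Z.gcd_eq_0_l (Z.of_nat d) (Z.of_nat d').
  by have := Z.gcd_nonneg (Z.of_nat d) (Z.of_nat d'); lia.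
have le_gd : (g <= Z.of_nat d)%Z.
  by apply: Z.divide_pos_le (Z.gcd_divide_l _ _); lia.
suff : (Z.of_nat d' <= g)%Z by lia.
apply: (primitive_prefix n_gt0 _ aper) => //; first lia.
  exact: Z.gcd_divide_r.
have g_run k : (0 <= k < Z.of_nat (c + d - 1) - g)%Z ->
    cyclic s (k + g)%Z = cyclic s k.
  move=> k_le; apply: (@Fine_Wilf _ _ (Z.of_nat (c + d - 1)) (Z.of_nat d)
    (Z.of_nat d')) => //; try lia.
    by move=> h h_le; rewrite run //; lia.
  by move=> h h_le; rewrite run' //; lia.
by move=> k k' k_le k'_le; apply: (run_mod g_gt0 g_run); lia.
Qed.

Lemma spacing_Bset n c d (s : n.-tuple bool) :
  0 < c -> n./2 <= c -> 0 < d -> d <= n./2 -> c + d <= n ->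
  s \in Bset n c d -> spacing c s = d.
Proof.
move=> c_gt0 le_c d_gt0 le_d le_cd sB; rewrite /spacing.
case: pickP => [d' /andP [d'_gt0 sB']|none].
  have d'_lt := ltn_ord d'.
  have [lt_d|lt_d'|//] := ltngtP d' d; exfalso.
    by apply: (Bset_inj _ _ _ _ _ _ sB' sB); lia.
  by apply: (Bset_inj _ _ _ _ _ _ sB sB'); lia.
have d_lt : d < (minn (n - c) n./2).+1 by lia.
by have := none (Ordinal d_lt); rewrite /= d_gt0 sB.
Qed.

Lemma BunionP n c (s : n.-tuple bool) : c < n ->
  reflect (exists d, [/\ 0 < d, d <= n./2, c + d <= n & s \in Bset n c d])
    (s \in Bunion n c).
Proof.
have bigcup_has r : (s \in \bigcup_(d <- r) Bset n c d)
    = has (fun d => s \in Bset n c d) r.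
  elim: r => [|d r IHr]; first by rewrite big_nil inE.
  by rewrite big_cons in_setU IHr.
move=> lt_cn; rewrite /Bunion bigcup_has; apply: (iffP hasP).
  move=> [d]; rewrite mem_index_iota => d_in sB.
  by exists d; split=> //; lia.
move=> [d [d_gt0 le_d le_cd sB]]; exists d => //.
by rewrite mem_index_iota; lia.
Qed.

(** * The value of [add] as the length of the run to the left of [0] *)

Lemma nth_add_spaced n d (s : n.-tuple bool) (i : nat) : 0 < d -> d <= n ->
  i < n ->
  (nth false s (n - 1 - i) != nth false s (d - 1 - i %% d)) =
  (cyclic s (- 1 - Z.of_nat i)%Z
    != cyclic s (Z.of_nat d - 1 - Z.of_nat (i %% d))%Z).
Proof.
move=> d_gt0 le_dn i_lt; have i_mod := ltn_pmod i d_gt0.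
have n_gt0 : 0 < n by lia.
rewrite -(cyclicD s n_gt0 (- 1 - Z.of_nat i)) -!(cyclic_nat s n_gt0); try lia.
by congr (cyclic s _ != cyclic s _); lia.
Qed.

Lemma sub_mod_eq (i d : nat) : 0 < d ->
  ((- 1 - Z.of_nat i) mod Z.of_nat d
    = (Z.of_nat d - 1 - Z.of_nat (i %% d)) mod Z.of_nat d)%Z.
Proof.
move=> d_gt0; have iE := divn_eq i d.
rewrite (_ : Z.of_nat d - 1 - Z.of_nat (i %% d)
  = - 1 - Z.of_nat i + (1 + Z.of_nat (i %/ d)) * Z.of_nat d)%Z.
  by rewrite Z_mod_plus_full.
by rewrite [X in (_ = - 1 - Z.of_nat X + _)%Z]iE; nia.
Qed.

Lemma add_spaced_ge n d (s : n.-tuple bool) (t : nat) : 0 < d -> d <= n ->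
  t <= n ->
  (forall k, - Z.of_nat t <= k < 0 ->
    cyclic s (k + Z.of_nat d) = cyclic s k)%Z ->
  t <= add_spaced d s.
Proof.
move=> d_gt0 le_dn le_tn run; rewrite leqNgt; apply/negP => lt_t.
set i := add_spaced d s in lt_t.
have has_i : has (fun t => nth false s (n - 1 - t)
    != nth false s (d - 1 - t %% d)) (iota 0 n).
  by rewrite has_find size_iota; exact: leq_trans lt_t le_tn.
have := nth_find 0 has_i; rewrite -/(add_spaced d s) -/i nth_iota; last lia.
rewrite add0n nth_add_spaced //; last lia.
have i_mod := ltn_pmod i d_gt0.
move=> /eqP; apply; apply: (run_mod _ run); try lia.
exact: sub_mod_eq.
Qed.

Lemma add_spaced_run n d (s : n.-tuple bool) : 0 < d -> d <= n ->
  forall k, (- Z.of_nat (add_spaced d s) <= k < 0)%Z ->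
  cyclic s (k + Z.of_nat d)%Z = cyclic s k.
Proof.
move=> d_gt0 le_dn.
have le_add : add_spaced d s <= n.
  by rewrite -[X in _ <= X](size_iota 0) find_size.
have eq_i i : i < add_spaced d s -> cyclic s (- 1 - Z.of_nat i)%Z
    = cyclic s (Z.of_nat d - 1 - Z.of_nat (i %% d))%Z.
  move=> lt_i; have := before_find 0 lt_i; rewrite nth_iota; last lia.
  by rewrite add0n nth_add_spaced //; [move=> /negPn /eqP | lia].
move=> k k_in; pose i := Z.to_nat (- 1 - k).
have -> : k = (- 1 - Z.of_nat i)%Z by lia.
rewrite (eq_i i); last lia.
have [lt_id|le_di] := ltnP i d.
  by rewrite modn_small //; congr cyclic; lia.
(* Indices [i] and [i - d] are compared with the same letter, so the letters they designate
   agree. *)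
have := eq_i (i - d) ltac:(lia).
rewrite -(modnDr (i - d)) subnK // => <-.
by congr cyclic; lia.
Qed.

Lemma add_spaced_max n c d (s : n.-tuple bool) :
  0 < c -> 0 < d -> c + d <= n -> s \in Bset n c d ->
  add_spaced d s < n /\
  cyclic s (- Z.of_nat (add_spaced d s) - 1 + Z.of_nat d)%Z
    <> cyclic s (- Z.of_nat (add_spaced d s) - 1)%Z.
Proof.
move=> c_gt0 d_gt0 le_cd sB; have n_gt0 : 0 < n by lia.
have [_ _ _ viol] := iffLR (BsetP s n_gt0 c_gt0 d_gt0 le_cd) sB.
have le_dn : d <= n by lia.
have run := add_spaced_run (s := s) d_gt0 le_dn.
(* A [d]-run on [-n..-1] would cover [c - 1 - n], a translate of the violation at [c - 1]. *)
have lt_add : add_spaced d s < n.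
  rewrite ltnNge; apply/negP => le_n; apply: viol.
  have per z : cyclic s z = cyclic s (z - Z.of_nat n)%Z.
    by rewrite -(cyclicD s n_gt0 (z - _)); congr cyclic; lia.
  rewrite per [RHS]per -(run (_ - _ - _)%Z); last lia.
  by congr cyclic; lia.
split=> // eq_t.
set t := add_spaced d s in run lt_add eq_t.
have has_t : has (fun t => nth false s (n - 1 - t)
    != nth false s (d - 1 - t %% d)) (iota 0 n).
  by rewrite has_find size_iota.
have t_mod := ltn_pmod t d_gt0.
have := nth_find 0 has_t; rewrite -/(add_spaced d s) -/t nth_iota //.
rewrite add0n nth_add_spaced // => /eqP; apply.
have run_t k : (- Z.of_nat t - 1 <= k < 0)%Z ->
    cyclic s (k + Z.of_nat d)%Z = cyclic s k.
  move=> k_in; have [->|k_neq] := Z.eq_dec k (- Z.of_nat t - 1) => //.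
  by apply: run; lia.
apply: (run_mod _ run_t); try lia.
exact: sub_mod_eq.
Qed.

(** * Rotations as translations *)

Lemma cyclic_inj n (a b : n.-tuple bool) : cyclic a =1 cyclic b -> a = b.
Proof.
move=> eq_ab; apply/val_inj/(@eq_from_nth _ false); rewrite ?size_tuple //.
by move=> i i_lt; rewrite -!cyclic_nat ?eq_ab //; lia.
Qed.

Lemma cyclic_rotr n k (s : n.-tuple bool) z : k < n ->
  cyclic [tuple of rotr k s] z = cyclic s (z - Z.of_nat k)%Z.
Proof.
move=> lt_kn; have n_gt0 : 0 < n by lia.
have z_mod := Z.mod_pos_bound z (Z.of_nat n) ltac:(lia).
have zE := Z.div_mod z (Z.of_nat n) ltac:(lia).
pose i := Z.to_nat (z mod Z.of_nat n).
rewrite [LHS]/cyclic /= size_rotr size_tuple -/i /rotr /rot size_tuple.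
have iE : Z.of_nat i = (z mod Z.of_nat n)%Z by rewrite Z2Nat.id; lia.
have lt_in : i < n by lia.
have cycE j : j < n -> (Z.of_nat j = Z.of_nat i - Z.of_nat k
    \/ Z.of_nat j = Z.of_nat i - Z.of_nat k + Z.of_nat n)%Z ->
    nth false s j = cyclic s (z - Z.of_nat k)%Z.
  move=> j_lt jE; rewrite -(cyclic_nat s n_gt0 j_lt).
  apply: (periodic_mod _ (cyclicD s n_gt0)); first lia.
  have {}jE : exists b, Z.of_nat j = (z - Z.of_nat k + b * Z.of_nat n)%Z.
    by case: jE => jE; [exists (- (z / Z.of_nat n))%Z
                       |exists (1 - z / Z.of_nat n)%Z]; nia.
  by have [b ->] := jE; rewrite Z_mod_plus_full.
rewrite nth_cat size_drop size_tuple.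
have [lt_ik|le_ki] := ltnP i (n - (n - k)).
  by rewrite nth_drop; apply: cycE; lia.
by rewrite nth_take; [apply: cycE|]; lia.
Qed.

Lemma rotr_cyclic n (s : n.-tuple bool) (m : Z) : 0 < n ->
  exists k : 'I_n, forall z, cyclic [tuple of rotr k s] z = cyclic s (z + m)%Z.
Proof.
move=> n_gt0; have m_mod := Z.mod_pos_bound (- m) (Z.of_nat n) ltac:(lia).
have k_lt : Z.to_nat ((- m) mod Z.of_nat n) < n by lia.
exists (Ordinal k_lt) => z; rewrite cyclic_rotr //= Z2Nat.id; last lia.
apply: (periodic_mod _ (cyclicD s n_gt0)); first lia.
rewrite Zminus_mod Zmod_mod -Zminus_mod; congr (_ mod _)%Z; lia.
Qed.

(** If [a] is a power of a block of length [k], then [cyclic a] has period [k], and so has its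
    translate [cyclic s]. *)
Lemma aperiodic_shift n (a s : n.-tuple bool) (m : Z) :
  (forall z, cyclic a z = cyclic s (z + m)%Z) -> aperiodic s -> aperiodic a.
Proof.
move=> aE aper; apply/negPn/negP => /aperiodicPn [k []].
rewrite size_tuple => k_lt k_dvd a_mod.
have n_gt0 : 0 < n by lia.
have k_gt0 : 0 < k by rewrite (dvdn_gt0 _ k_dvd).
apply: (aperiodic_cyclic n_gt0 aper _ k_dvd) => [|i]; first by rewrite k_gt0.
have lt_modk j : j %% k < n by apply: leq_trans (ltn_pmod _ k_gt0) (ltnW k_lt).
have red z : cyclic a z = cyclic a (z mod Z.of_nat k)%Z.
  have := Z.mod_pos_bound z (Z.of_nat n) ltac:(lia) => z_mod.
  pose j := Z.to_nat (z mod Z.of_nat n).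
  have jE : Z.of_nat j = (z mod Z.of_nat n)%Z by rewrite Z2Nat.id; lia.
  rewrite (_ : cyclic a z = nth false a j); last by rewrite /cyclic size_tuple.
  rewrite a_mod; last lia.
  rewrite -(cyclic_nat a n_gt0) //; congr cyclic.
  have [b nE] := dvdnP k_dvd.
  apply: (@Z.mod_unique_pos _ _ (Z.of_nat (j %/ k)
    + Z.of_nat b * (z / Z.of_nat n))); first by have := ltn_pmod j k_gt0; lia.
  have jE' := divn_eq j k; have zE := Z.div_mod z (Z.of_nat n) ltac:(lia).
  by nia.
rewrite -(Z.sub_add m i) -Z.add_assoc (Z.add_comm m) Z.add_assoc -!aE.
by rewrite red [RHS]red -[X in (_ + X)%Z]Z.mul_1_l Z_mod_plus_full.
Qed.

(** * Complexity of the periodic extension of a representative *)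

Section Representative.

Variables (n c d : nat) (s : n.-tuple bool).
Hypotheses (c_gt0 : 0 < c) (le_c : n./2 <= c) (d_gt0 : 0 < d)
  (le_d : d <= n./2) (le_cd : c + d <= n) (sB : s \in Bset n c d).
Hypothesis add_max : forall (a : n.-tuple bool) (m : Z) (e : nat),
  (forall z, cyclic a z = cyclic s (z + m)%Z) ->
  0 < e -> e <= n./2 -> c + e <= n -> a \in Bset n c e ->
  add_spaced e a <= add_spaced d s.

Local Notation t := (add_spaced d s).
Local Notation u := (cyclic s).

Let n_gt0 : 0 < n. Proof. by lia. Qed.

(* By descent on [e], the [e]-window in front of the violation may be taken
   aperiodic; the rotation starting there then lies in [Bset n c e] and beats
   the maximality of [t]. *)
Lemma no_short_run (e : nat) (z : Z) : 0 < e -> e <= n./2 -> c + e <= n ->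
  (forall k, z - Z.of_nat (c + t) <= k < z -> u (k + Z.of_nat e) = u k)%Z ->
  u (z + Z.of_nat e)%Z = u z.
Proof.
have [lt_tn _] := add_spaced_max c_gt0 d_gt0 le_cd sB.
have [aper _ _ _] := iffLR (BsetP s n_gt0 c_gt0 d_gt0 le_cd) sB.
elim/ltn_ind: e z => e IHe z e_gt0 le_e le_ce run.
have [//|viol] := eqVneq (u (z + Z.of_nat e)%Z) (u z); exfalso.
(* The rotation brings the violation from [z] to [c - 1] and the run to [-t - 1..c - 2], one step
   further left than maximality allows. *)
have [k aE] := rotr_cyclic s (z - Z.of_nat c + 1)%Z n_gt0.
set a := [tuple of rotr k s] in aE.
have [aper_e|] := boolP (aperiodic (take e a)).
  suff : t < add_spaced e a.
    rewrite ltnNge (@add_max a (z - Z.of_nat c + 1)%Z e) //.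
    apply/BsetP => //; split=> //; first exact: aperiodic_shift aE aper.
      move=> j j_in; rewrite !aE -(run (j + (z - Z.of_nat c + 1))%Z); last lia.
      by congr cyclic; lia.
    rewrite !aE; apply/eqP; move: viol; congr (cyclic s _ != cyclic s _); lia.
  apply: add_spaced_ge; try lia.
  move=> j j_in; rewrite !aE -(run (j + (z - Z.of_nat c + 1))%Z); last lia.
  by congr cyclic; lia.
move=> /aperiodicPn [g]; rewrite size_takel ?size_tuple; last lia.
move=> [lt_ge g_dvd a_mod].
have g_gt0 : 0 < g by rewrite (dvdn_gt0 _ g_dvd).
have g_dvdZ : (Z.of_nat g | Z.of_nat e)%Z.
  by have [b ->] := dvdnP g_dvd; exists (Z.of_nat b); lia.
have {}a_mod i : i < e -> nth false a i = nth false a (i %% g).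
  move=> i_lt; have := a_mod i i_lt; rewrite !nth_take //.
  exact: leq_trans (ltn_pmod _ g_gt0) (ltnW lt_ge).
have g_run j : (z - Z.of_nat c + 1 <= j
    < z - Z.of_nat c + 1 + Z.of_nat e - Z.of_nat g)%Z ->
    u (j + Z.of_nat g)%Z = u j.
  move=> j_in; pose i := Z.to_nat (j - (z - Z.of_nat c + 1)).
  have -> : j = (Z.of_nat i + (z - Z.of_nat c + 1))%Z by lia.
  have -> : (Z.of_nat i + (z - Z.of_nat c + 1) + Z.of_nat g
    = Z.of_nat (i + g) + (z - Z.of_nat c + 1))%Z by lia.
  rewrite -!aE !cyclic_nat //; try lia.
  by rewrite (a_mod (i + g)) ?(a_mod i) ?modnDr //; lia.
have g_gt0Z : (0 < Z.of_nat g)%Z by lia.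
have e_gt0Z : (0 < Z.of_nat e)%Z by lia.
have w_in : (z - Z.of_nat (c + t) <= z - Z.of_nat c + 1 <= z)%Z by lia.
have period := window_period g_gt0Z g_dvdZ e_gt0Z run w_in g_run.
(* The period [g] spreads over the whole range of the [e]-run, and the violation becomes one of
   difference [g] at [z + e - g], where induction applies. *)
have eq_ze : u (z + Z.of_nat e - Z.of_nat g)%Z = u z.
  apply: period; try lia.
  have [b ->] := g_dvdZ.
  rewrite (_ : _ - _ = z + (b - 1) * Z.of_nat g)%Z; last lia.
  by rewrite Z_mod_plus_full.
have := IHe g lt_ge (z + Z.of_nat e - Z.of_nat g)%Z g_gt0.
rewrite Z.sub_add eq_ze => E.
move: viol; rewrite E ?eqxx //; try lia.
move=> j j_in; apply: period; try lia.
by rewrite (_ : j + _ = j + 1 * Z.of_nat g)%Z ?Z_mod_plus_full //; lia.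
Qed.

(** When [c + e > n], maximality of [add] cannot be invoked; the run then either wraps round the
    circle and reaches [z - n], or contradicts the [d]-run by [two_runs]. *)
Lemma no_half_run (e : nat) (z : Z) : 0 < e -> e <= n./2 ->
  (forall k, z - Z.of_nat (c + t) <= k < z -> u (k + Z.of_nat e) = u k)%Z ->
  u (z + Z.of_nat e)%Z = u z.
Proof.
move=> e_gt0 le_e run.
have [le_ce|lt_ce] := leqP (c + e) n; first exact: no_short_run.
have [lt_tn left_viol] := add_spaced_max c_gt0 d_gt0 le_cd sB.
have [_ _ d_run d_viol] := iffLR (BsetP s n_gt0 c_gt0 d_gt0 le_cd) sB.
have t_run : forall k, (- Z.of_nat t <= k < 0)%Z -> u (k + Z.of_nat d)%Z = u k.
  by apply: add_spaced_run; lia.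
have per k : u (k + Z.of_nat n)%Z = u k by apply: cyclicD.
have [lt_ctn|le_nct] := ltnP (c + t) n; last first.
  have -> : u z = u (z - Z.of_nat n)%Z by rewrite -[RHS]per; congr cyclic; lia.
  rewrite -(run (z - _)%Z); last lia.
  by rewrite -[RHS]per; congr cyclic; lia.
(* Translation by [z0] puts the start of the [e]-run at [0]; the case assumption gives [n - e < c],
   as [two_runs] requires. *)
exfalso; pose z0 := (z - Z.of_nat (c + t))%Z.
apply: (@two_runs _ (Z.of_nat n) (Z.of_nat (c + t) - 1) (Z.of_nat (c + t))
  (- Z.of_nat t - z0) (Z.of_nat d) (Z.of_nat e) (fun k => u (z0 + k)%Z));
  try lia.
- by move=> k; rewrite -[RHS]per; congr cyclic; lia.
- move=> k k_in; rewrite Z.add_assoc.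
  have [lt_k|le_k] := Z.lt_ge_cases (z0 + k) 0; first by apply: t_run; lia.
  by apply: d_run; lia.
- move=> E; apply: left_viol.
  rewrite (_ : _ + Z.of_nat d = z0 + (- Z.of_nat t - z0 - 1 + Z.of_nat d))%Z.
    by rewrite E; congr cyclic; lia.
  lia.
- move=> E; apply: d_viol.
  rewrite (_ : Z.of_nat c - 1 = z0 + (- Z.of_nat t - z0
    + (Z.of_nat (c + t) - 1)))%Z; last lia.
  by rewrite -Z.add_assoc.
- by move=> k k_in; rewrite Z.add_assoc run //; lia.
Qed.

Lemma nlc_inf_representative : nlc_inf (periodic_ext s) = c + t.
Proof.
have [lt_tn _] := add_spaced_max c_gt0 d_gt0 le_cd sB.
have [_ _ d_run d_viol] := iffLR (BsetP s n_gt0 c_gt0 d_gt0 le_cd) sB.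
have t_run : forall k, (- Z.of_nat t <= k < 0)%Z -> u (k + Z.of_nat d)%Z = u k.
  by apply: add_spaced_run; lia.
have per k : u (k + Z.of_nat n)%Z = u k by apply: cyclicD.
apply: nlc_of_eq => [|m lt_m].
  apply/fsr_generatesP => i j _ _ eq_ij.
  rewrite -!(cyclic_periodic_ext s n_gt0).
  pose e := Z.to_nat ((Z.of_nat i - Z.of_nat j) mod Z.of_nat n).
  have mod_lt := Z.mod_pos_bound (Z.of_nat i - Z.of_nat j) (Z.of_nat n)
    ltac:(lia).
  have eE k : u (k + Z.of_nat e)%Z = u (k + (Z.of_nat i - Z.of_nat j))%Z.
    apply: (periodic_mod _ (cyclicD s n_gt0)); first lia.
    by rewrite Z2Nat.id ?Zplus_mod_idemp_r //; lia.
  have run k : (Z.of_nat (j + (c + t)) - Z.of_nat (c + t) <= k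
      < Z.of_nat (j + (c + t)))%Z -> u (k + Z.of_nat e)%Z = u k.
    move=> k_in; pose h := Z.to_nat (k - Z.of_nat j).
    have := eq_ij h ltac:(lia); rewrite -!(cyclic_periodic_ext s n_gt0).
    rewrite eE (_ : k = Z.of_nat (j + h)); last lia.
    by move=> <-; congr cyclic; lia.
  have <- : u (Z.of_nat (j + (c + t)) + Z.of_nat e)%Z
      = u (Z.of_nat (i + (c + t))) by rewrite eE; congr cyclic; lia.
  have [e0|e_gt0] := posnP e; first by rewrite e0 Z.add_0_r.
  have [le_e|lt_e] := leqP e n./2; first exact: no_half_run.
  (* For [e > n./2] the two windows exchange roles: the difference becomes [n - e] and the run ends
     at the other window. *)
  have := @no_half_run (n - e) (Z.of_nat (j + (c + t)) + Z.of_nat e)%Z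
    ltac:(lia) ltac:(lia).
  rewrite (_ : _ + _ + Z.of_nat (n - e)
    = Z.of_nat (j + (c + t)) + Z.of_nat n)%Z; last lia.
  rewrite per => -> // k k_in.
  rewrite -{2}(Z.sub_add (Z.of_nat e) k) run; last lia.
  by rewrite -[RHS]per; congr cyclic; lia.
move=> /fsr_generatesP gen; apply: d_viol.
(* Both windows end just before a violation position; the summand [n] keeps their starts
   nonnegative, since [m] may exceed [c - 1]. *)
have := gen (n + c - 1 - m + d) (n + c - 1 - m) isT isT.
rewrite -!(cyclic_periodic_ext s n_gt0) => viol.
rewrite -(per (Z.of_nat c - 1)%Z) -(per (Z.of_nat c - 1 + _)%Z).
rewrite (_ : _ + Z.of_nat n = Z.of_nat (n + c - 1 - m + d + m))%Z; last lia.
rewrite viol; first by congr cyclic; lia.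
move=> k k_lt; rewrite -!(cyclic_periodic_ext s n_gt0).
pose h := (Z.of_nat c - 1 - Z.of_nat m + Z.of_nat k)%Z.
rewrite (_ : Z.of_nat (n + c - 1 - m + d + k) = h + Z.of_nat d + Z.of_nat n)%Z;
  last lia.
rewrite (_ : Z.of_nat (n + c - 1 - m + k) = h + Z.of_nat n)%Z; last lia.
rewrite !per; have [lt_h|le_h] := Z.lt_ge_cases h 0; first by apply: t_run; lia.
by apply: d_run; lia.
Qed.

End Representative.

Theorem theorem2 (n c : nat) (n_ge2 : 2 <= n) (c_ge1 : 1 <= c) (c_ltn : c < n)
    (c_ge_half : n./2 <= c) (s : n.-tuple bool) (sR : s \in Rset n c) :
  nlc_inf (periodic_ext s) = nlc s + add c s.
Proof.
have [s0 s0B] := bigcupP sR; rewrite inE => /andP [sE /forallP s_max].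
have n_gt0 : 0 < n by lia.
have [/imsetP [k0 _ s_rot] sB] := setIP sE.
have [d [d_gt0 le_d le_cd {}sB]] := BunionP s c_ltn sB.
have sp e (a : n.-tuple bool) : 0 < e -> e <= n./2 -> c + e <= n ->
    a \in Bset n c e -> add c a = add_spaced e a.
  by move=> *; rewrite /add (@spacing_Bset n c e).
rewrite (sp d) // (nlc_Bset _ _ d_gt0 le_d le_cd sB) //.
apply: nlc_inf_representative => // a m e aE e_gt0 le_e le_ce aB.
rewrite -!sp //; have /implyP := s_max a; apply; apply/setIP; split; last first.
  by apply/BunionP => //; exists e.
(* A translate of [s] is also a rotation of [s0], over whose class [s] is maximal. *)
have [k kE] := rotr_cyclic s0 (m - Z.of_nat k0)%Z n_gt0.
apply/imsetP; exists k => //; apply: cyclic_inj => z.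
by rewrite kE aE s_rot cyclic_rotr //; congr cyclic; lia.
Qed.
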